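(* Let $a>0$, let $g_0,g_1\in C^1([0,1])$, and let $\Delta$ be an admissible set of initial conditions for the nonlocal problem (N) (see context). Suppose that $g_0(0)=g_0(1)=g_1(0)=g_1(1)=0$ and that $$\sup_{0<z<1}\left(\frac{|g_0(z)|}{\sin(\pi z)}\right)+\sup_{0<z<1}\left(\frac{|g_1(z)|}{\sin(\pi z)}\right)<\pi.$$ Then there exist constants $M,\delta>0$ such that for every $x_0\in\Delta$ the unique solution $x$ of (N) with initial condition $x_0$ satisfies, for all $t\ge0$, $$\|x[t]\|_{1,w}\le M e^{-\delta t}\|x[0]\|_{1,w},$$ where $\|x[t]\|_{1,w}:=\int_0^1\sin(\pi z)|x(t,z)|dz$.
   Context: $\mathbb{R}_+=[0,+\infty)$. For a function $x$ on $\mathbb{R}_+\times[0,1]$, $x[t]$ denotes the profile $z\mapsto x(t,z)$. Problem (N): $\frac{\partial x}{\partial t}(t,z)=a\frac{\partial^2x}{\partial z^2}(t,z)$ for $(t,z)\in(0,+\infty)\times(0,1)$, with nonlocal boundary conditions $x(t,0)=\int_0^1g_0(z)x(t,z)dz$ and $x(t,1)=\int_0^1g_1(z)x(t,z)dz$ for $t\ge 0$. A solution with initial condition $x_0$ is a function $x\in C^0(\mathbb{R}_+\times[0,1])\cap C^1((0,+\infty)\times[0,1])$ satisfying these, with $x[t]\in C^2([0,1])$ for all $t\ge0$ and $x(0,z)=x_0(z)$ for all $z\in[0,1]$. Standing assumption: there exists an admissible set of initial conditions $\Delta$, i.e. a non-empty set $$\Delta\subseteq\left\{x\in C^2([0,1]):x(0)-\int_0^1g_0(z)x(z)dz=x(1)-\int_0^1g_1(z)x(z)dz=0\right\}$$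 which is dense in $L^2$ (i.e. $L^2(0,1)$) and such that for every $x_0\in\Delta$ problem (N) with initial condition $x_0$ has a unique solution. *)

(* Defs.v *)
From HB Require Import structures.
From mathcomp Require Import all_boot all_order all_algebra.
From mathcomp Require Import all_classical all_reals all_analysis.
Import Order.TTheory GRing.Theory Num.Theory.
Import numFieldNormedType.Exports.

Set Implicit Arguments.
Unset Strict Implicit.
Unset Printing Implicit Defensive.

Local Open Scope classical_set_scope.
Local Open Scope ring_scope.

(* A function on a subset A of R (resp. A x B of R^2) is represented by a total
   function on R (resp. a curried function R -> R -> R); only its values on A
   (resp. A x B) are ever used.  *)

(* The limit is taken inside A, so this is the one-sided derivative at an
   endpoint of an interval A. *)
Definition deriv_within (R : realType) (A : set R) (f : R -> R) (z l : R) :=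
  (f y - f z) / (y - z) @[y --> within A z^'] --> l.

Fixpoint C_on (R : realType) (A : set R) (n : nat) (f : R -> R) : Prop :=
  {within A, continuous f} /\
  (if n is m.+1 then
     exists f', (forall z, A z -> deriv_within A f z (f' z)) /\ C_on A m f'
   else True).

Definition C0_on2 (R : realType) (A B : set R) (x : R -> R -> R) :=
  {within A `*` B, continuous (fun p : R * R => x p.1 p.2)}.

Definition C1_on2 (R : realType) (A B : set R) (x : R -> R -> R) :=
  C0_on2 A B x /\
  exists xt xz : R -> R -> R,
    [/\ forall t z, A t -> B z -> deriv_within A (x^~ z) t (xt t z),
        forall t z, A t -> B z -> deriv_within B (x t) z (xz t z),
        C0_on2 A B xt & C0_on2 A B xz].

Definition int01 (R : realType) (f : R -> R) : R :=
  Rintegral (@lebesgue_measure R) `[0, 1] f.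

(* At the interior points where the equation is required, the regularity
   fields make the derivatives of both sides exist, so that no default value
   of derive1 is involved. *)
Record is_solution (R : realType) (a : R) (g0 g1 x0 : R -> R)
    (x : R -> R -> R) : Prop := IsSolution {
  sol_C0 : C0_on2 `[0, +oo[ `[0, 1] x;
  sol_C1 : C1_on2 `]0, +oo[ `[0, 1] x;
  sol_C2 : forall t, 0 <= t -> C_on `[0, 1] 2 (x t);
  sol_pde : forall t z, 0 < t -> 0 < z < 1 ->
    derive1 (x^~ z) t = a * derive1n 2 (x t) z;
  sol_bc0 : forall t, 0 <= t -> x t 0 = int01 (fun z => g0 z * x t z);
  sol_bc1 : forall t, 0 <= t -> x t 1 = int01 (fun z => g1 z * x t z);
  sol_init : forall z, 0 <= z <= 1 -> x 0 z = x0 z }.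

Definition has_unique_solution (R : realType) (a : R) (g0 g1 x0 : R -> R) :=
  exists2 x, is_solution a g0 g1 x0 x &
    forall y, is_solution a g0 g1 x0 y ->
      forall t z, 0 <= t -> 0 <= z <= 1 -> y t z = x t z.

(* L^2(0,1) is seen inside L^2(R) through extension by 0 (f \_ A). *)
Definition dense_L2 (R : realType) (D : set (R -> R)) :=
  forall f : R -> R,
    f \_ `]0, 1[ \in Lfun (@lebesgue_measure R) 2%:E ->
  forall e : R, 0 < e ->
  exists2 y, D y &
    (Lnorm (@lebesgue_measure R) 2%:E
       (EFin \o ((fun z => f z - y z)%R \_ `]0%R, 1%R[)) < e%:E)%E.

Record admissible (R : realType) (a : R) (g0 g1 : R -> R)
    (D : set (R -> R)) : Prop := Admissible {
  adm_nonempty : D !=set0;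
  adm_C2 : forall y, D y -> C_on `[0, 1] 2 y;
  adm_bc0 : forall y, D y -> y 0 - int01 (fun z => g0 z * y z) = 0;
  adm_bc1 : forall y, D y -> y 1 - int01 (fun z => g1 z * y z) = 0;
  adm_dense : dense_L2 D;
  adm_wp : forall y, D y -> has_unique_solution a g0 g1 y }.

(* Extended-real valued, so that an unbounded quotient gives +oo. *)
Definition sup_over_sin (R : realType) (g : R -> R) : \bar R :=
  ereal_sup [set (`|g z| / sin (pi * z))%:E | z in `]0, 1[].

Definition norm1w (R : realType) (y : R -> R) : R :=
  int01 (fun z => sin (pi * z) * `|y z|).

(* Main.v *)
Require Import Defs.
From HB Require Import structures.
From mathcomp Require Import all_boot all_order all_algebra.
From mathcomp Require Import all_classical all_reals all_analysis.
From mathcomp Require Import ring lra.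
Import Order.TTheory GRing.Theory Num.Theory.
Import numFieldNormedType.Exports.

Set Implicit Arguments.
Unset Strict Implicit.
Unset Printing Implicit Defensive.

Local Open Scope classical_set_scope.
Local Open Scope ring_scope.

(** The weight [sin (pi z)] is the first Dirichlet eigenfunction of the second
    derivative: it is positive inside the interval, vanishes at both ends with
    slopes [pi] and [- pi], and satisfies [w'' = - pi^2 w].  Let [V t] be the
    weighted norm of the profile at time [t].  Formally, the equation and two
    integrations by parts give Kato's inequality
      [V' <= a int w |x|_zz = a (pi (|x(t,0)| + |x(t,1)|) - pi^2 V]),
    and the nonlocal boundary conditions bound the traces by the same norm:
    [|x(t,i)| <= int |g_i| |x| <= K_i V], where [K_i] is the supremum of
    [|g_i| / w].  So [V' <= - delta V] with [delta = a pi (pi - K_0 - K_1)],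
    which is positive by the assumption on the suprema, and the estimate holds
    with [M = 1].

    To make this rigorous, [|u|] is replaced by the smooth convex function
    [softabs e u = sqrt (u^2 + e^2)], which differs from it by at most [e].
    The regularised norm [soft_norm1w e (x t)] is differentiable for [t > 0]
    ([is_derive_soft_norm1w]), its derivative is bounded through
    [weighted_kato], and [linear_gronwall] integrates the resulting inequality
    from time [0], where only continuity is available
    ([continuous_int01]).  The regularisation costs a term of order [e] in
    [soft_norm1w_decay], which disappears as [e] tends to [0]. *)

(** * One-sided derivatives and functions continuous on a product *)

Section within_regularity.
Context {R : realType}.
Implicit Types (A B : set R) (u : R -> R -> R).

Lemma deriv_within_is_derive A (f : R -> R) (z l : R) :
  nbhs z A -> deriv_within A f z l -> is_derive z 1 f l.
Proof.
move=> zA fzl.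
suff H : h^-1 *: (f (h *: 1 + z) - f z) @[h --> 0^'] --> l.
  by apply: DeriveDef; [apply/cvg_ex; exists l | apply/cvg_lim].
have shiftz : h + z @[h --> 0^'] --> within A z^'.
  move=> P /= zP.
  have : nbhs z (fun y => y != z -> P y).
    have zP' : nbhs z (fun y => y != z -> A y -> P y) by exact: zP.
    by apply: filterS2 zP' zA => y Py Ay yz; exact: Py.
  move=> /nbhs_ballP[e e0 eP]; apply/nbhs_ballP; exists e => // h he h0.
  apply: eP; last by rewrite -subr_eq0 addrK.
  by move: he; rewrite /ball/= sub0r normrN opprD addrCA subrr addr0 normrN.
have := cvg_comp _ _ shiftz fzl.
apply: cvg_trans; apply: near_eq_cvg; near=> h.
by rewrite /= /GRing.scale/= mulr1 addrK mulrC.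
Unshelve. all: by end_near. Qed.

Lemma C0_on2_row A B u (t : R) :
  C0_on2 A B u -> A t -> {within B, continuous (u t)}.
Proof.
move=> /subspace_continuousP cu At; apply/subspace_continuousP => z Bz.
have pz : (t, y) @[y --> within B (nbhs z)] --> within (A `*` B) (nbhs (t, z)).
  move=> P /= [[U V] /= [Ut Vz] UVP].
  apply: filterS Vz => y Vy By; apply: (UVP (t, y)) => //.
  by split => //=; exact: nbhs_singleton.
exact: (cvg_comp _ _ pz (cu (t, z) (conj At Bz))).
Qed.

Lemma C0_on2_swap A B u : C0_on2 A B u -> C0_on2 B A (fun z t => u t z).
Proof.
move=> /subspace_continuousP cu; apply/subspace_continuousP => -[z t] [/= Bz At].
have pz : (p.2, p.1) @[p --> within (B `*` A) (nbhs (z, t))] -->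
    within (A `*` B) (nbhs (t, z)).
  move=> P /= [[U V] /= [Ut Vz] UVP].
  exists (V, U) => //= -[y s] [/= Vy Us] [/= By As].
  exact: (UVP (s, y)).
exact: (cvg_comp _ _ pz (cu (t, z) (conj At Bz))).
Qed.

Lemma C0_on2_bounded A u (s t : R) :
  C0_on2 A `[0, 1] u -> `[s, t] `<=` A ->
  exists2 C : R, 0 <= C &
    forall r z : R, r \in `[s, t] -> z \in `[0, 1] -> `|u r z| <= C.
Proof.
move=> cu stA.
have cst : {within `[s, t] `*` `[0, 1], continuous (fun p : R * R => u p.1 p.2)}.
  by apply: continuous_subspaceW cu => -[r z] [/= /stA].
have := continuous_compact cst
  (compact_setX (@segment_compact R s t) (@segment_compact R 0 1)).
move=> /compact_bounded[M [_ Mu]]; exists (`|M| + 1); first by rewrite addr_ge0.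
move=> r z rst z01; apply: (Mu (`|M| + 1)) => //.
  by rewrite (le_lt_trans (ler_norm _))// ltrDl.
by exists (r, z).
Qed.

Lemma within_continuousM A (f g : R -> R) :
  {within A, continuous f} -> {within A, continuous g} ->
  {within A, continuous (fun z => f z * g z)}.
Proof. by move=> cf cg z; apply: cvgM; [exact: cf|exact: cg]. Qed.

Lemma within_continuous_post A (p f : R -> R) :
  continuous p -> {within A, continuous f} ->
  {within A, continuous (fun z => p (f z))}.
Proof. by move=> cp cf z; apply: continuous_comp; [exact: cf|exact: cp]. Qed.

Lemma within_continuous_cst A (k : R) : {within A, continuous (fun _ : R => k)}.
Proof. by apply: continuous_subspaceT; exact: cst_continuous. Qed.

Lemma nbhs_itvoo (z : R) : z \in `]0, 1[ -> nbhs z `]0, 1[%classic.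
Proof.
by move=> z01; apply: open_nbhs_nbhs; split; [exact: interval_open|exact: z01].
Qed.

Lemma C2_on_derivatives (y : R -> R) : C_on `[0, 1] 2 y ->
  exists y1 y2 : R -> R,
  [/\ {within `[0, 1], continuous y1}, {within `[0, 1], continuous y2},
     (forall z : R, z \in `]0, 1[ -> is_derive z 1 y (y1 z)),
     (forall z : R, z \in `]0, 1[ -> is_derive z 1 y1 (y2 z)) &
     (forall z : R, z \in `]0, 1[ -> derive1n 2 y z = y2 z)].
Proof.
move=> [_ [y1 [dy [cy1 [y2 [dy1 [cy2 _]]]]]]].
have nbhs01 (z : R) : z \in `]0, 1[ -> nbhs z `[0, 1]%classic.
  by move=> /nbhs_itvoo; apply: filterS; exact: subset_itv_oo_cc.
have dy' (z : R) : z \in `]0, 1[ -> is_derive z 1 y (y1 z).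
  move=> z01; apply: deriv_within_is_derive (nbhs01 z z01) (dy z _).
  exact: subset_itv_oo_cc.
have dy1' (z : R) : z \in `]0, 1[ -> is_derive z 1 y1 (y2 z).
  move=> z01; apply: deriv_within_is_derive (nbhs01 z z01) (dy1 z _).
  exact: subset_itv_oo_cc.
exists y1, y2; split=> // z z01.
have [_ <-] := dy1' z z01.
rewrite /derive1n/= derive1E; apply: near_eq_derive.
by apply: filterS (nbhs_itvoo z01) => w /dy'[_ <-]; rewrite derive1E.
Qed.

End within_regularity.

(** * Integrals over the unit interval *)

Section int01_theory.
Context {R : realType}.
Implicit Types f g : R -> R.

Lemma integrable01 f : {within `[0, 1], continuous f} ->
  (@lebesgue_measure R).-integrable `[0, 1] (EFin \o f).
Proof. by apply: continuous_compact_integrable; exact: segment_compact. Qed.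

Lemma eq_int01 f g : {in `[0, 1], f =1 g} -> int01 f = int01 g.
Proof. by move=> fg; apply: eq_Rintegral => z /[!inE] /fg. Qed.

Lemma ler_int01 f g :
  {within `[0, 1], continuous f} -> {within `[0, 1], continuous g} ->
  {in `[0, 1], forall z, f z <= g z} -> int01 f <= int01 g.
Proof. by move=> cf cg fg; apply: le_Rintegral => //; exact: integrable01. Qed.

Lemma int01D f g :
  {within `[0, 1], continuous f} -> {within `[0, 1], continuous g} ->
  int01 (fun z => f z + g z) = int01 f + int01 g.
Proof. by move=> cf cg; apply: RintegralD => //; exact: integrable01. Qed.

Lemma int01Z k f : {within `[0, 1], continuous f} ->
  int01 (fun z => k * f z) = k * int01 f.
Proof. by move=> cf; apply: RintegralZl => //; exact: integrable01. Qed.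

Lemma ler_norm_int01 f : {within `[0, 1], continuous f} ->
  `|int01 f| <= int01 (fun z => `|f z|).
Proof. by move=> cf; apply: le_normr_Rintegral => //; exact: integrable01. Qed.

Lemma int01_cst (k : R) : int01 (fun=> k) = k.
Proof.
rewrite /int01 Rintegral_cst//= lebesgue_measure_itv/= lte_fin ltr01.
by rewrite oppr0 adde0 /= mulr1.
Qed.

Lemma int01_derive (F f : R -> R) :
  {within `[0, 1], continuous F} -> {within `[0, 1], continuous f} ->
  (forall z : R, z \in `]0, 1[ -> is_derive z 1 F (f z)) ->
  int01 f = F 1 - F 0.
Proof.
move=> /(continuous_within_itvP _ ltr01)[_ F0 F1] cf dF.
have F01 : derivable_oo_LRcontinuous F 0 1 by split=> // z /dF[].
rewrite /int01 /Rintegral (continuous_FTC2 ltr01 cf F01)//.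
by move=> z /dF[_ <-]; rewrite derive1E.
Qed.

(** Differentiation under the integral sign, where a constant is an integrable
    dominating function because the interval is bounded. *)
Lemma is_derive_int01 (F Ft : R -> R -> R) (s t v C : R) :
  t \in `]s, v[ ->
  (forall r : R, r \in `]s, v[ -> {within `[0, 1], continuous (F r)}) ->
  (forall r z : R, r \in `]s, v[ -> z \in `[0, 1] ->
     is_derive r 1 (F^~ z) (Ft r z)) ->
  (forall r z : R, r \in `]s, v[ -> z \in `[0, 1] -> `|Ft r z| <= C) ->
  is_derive t 1 (fun r : R => int01 (F r)) (int01 (Ft t)).
Proof.
move=> tsv cF dF FtC.
have C0 : 0 <= C.
  by apply: le_trans (FtC t 0 tsv _) => //; rewrite in_itv/= lexx ler01.
have intF (r : R) : `]s, v[%classic r ->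
    lebesgue_measure.-integrable `[0, 1] (EFin \o F r).
  by move=> rsv; apply: integrable01; exact: cF.
have derF (r z : R) : `]s, v[%classic r -> `[0, 1]%classic z ->
    derivable (F^~ z) r 1.
  by move=> rsv z01; have [] := dF r z rsv z01.
have intC : lebesgue_measure.-integrable `[0, 1] (EFin \o (fun _ : R => C)).
  by apply: integrable01; exact: within_continuous_cst.
have ubF (r z : R) : `]s, v[%classic r -> `[0, 1]%classic z ->
    `|partial1of2 F r z| <= C.
  by move=> rsv z01; rewrite partial1of2E; have [_ ->] := dF r z rsv z01; exact: FtC.
apply: DeriveDef.
  exact: (derivable_under_integral _ tsv intF derF (fun=> C0) intC ubF).
rewrite -derive1E.
rewrite (differentiation_under_integral _ tsv intF derF (fun=> C0) intC ubF)//.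
apply: eq_Rintegral => z /[!inE] z01.
by rewrite partial1of2E; have [_ ->] := dF t z tsv z01.
Qed.

(** Freezing the integrand at its value at [0] for negative parameters makes
    [0] an interior parameter, so that dominated convergence on an open interval
    of parameters also gives continuity at the end [0] of the segment. *)
Lemma continuous_int01 (F : R -> R -> R) (T : R) :
  0 <= T -> C0_on2 `[0, +oo[ `[0, 1] F ->
  {within `[0, T], continuous (fun t : R => int01 (F t))}.
Proof.
move=> T0 cF.
pose G (t : R) := F (Num.max 0 t).
have [C C0 FC] : exists2 C : R, 0 <= C &
    forall r z : R, r \in `[0, T + 1] -> z \in `[0, 1] -> `|F r z| <= C.
  by apply: C0_on2_bounded cF _ => r /=; rewrite !in_itv/= => /andP[->].
have mx (t : R) : 0 <= Num.max 0 t by rewrite le_max lexx.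
have cG : {in `](-1), (T + 1)[%classic, continuous (fun t : R => int01 (G t))}.
  apply: (@continuity_under_integral R _ _ lebesgue_measure G `[0, 1] _
    (-1) (T + 1) _ _ (fun=> C)) => //.
  - move=> t _; apply: integrable01; apply: (C0_on2_row cF).
    by rewrite /= in_itv/= mx.
  - apply: aeW => z z01 t _.
    have := C0_on2_row (C0_on2_swap cF) z01.
    move=> /subspace_continuousP/(_ (Num.max 0 t)).
    rewrite /= in_itv/= mx => /(_ isT) cFz.
    apply: cvg_comp cFz.
    have cmax : Num.max 0 s @[s --> t] --> (Num.max 0 t : R).
      by apply: continuous_max; [exact: cst_continuous | exact: cvg_id].
    move=> P /= /cmax; rewrite !nbhs_simpl/=; apply: filterS => s; apply.
    by rewrite /= in_itv/= mx.
  - by apply: integrable01; exact: within_continuous_cst.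
  - move=> t /=; rewrite in_itv/= => /andP[_ tT]; apply: aeW => z z01.
    by apply: FC => //; rewrite in_itv/= mx/= ge_max (ltW tT) andbT addr_ge0.
have : {within `[0, T], continuous (fun t : R => int01 (G t))}.
  apply: continuous_in_subspaceT => t; rewrite inE/= in_itv/= => /andP[t0 tT].
  by apply: cG; rewrite inE/= in_itv/=; apply/andP; split; lra.
apply: subspace_eq_continuous => t; rewrite inE/= in_itv/= => /andP[t0 tT].
by rewrite /from_subspace/= /G max_r.
Qed.

End int01_theory.

(** * The sine weight and the regularised absolute value *)

Section weight_and_softabs.
Context {R : realType}.
Implicit Types (f g : R -> R) (e u z : R).

Lemma is_derive_mulr f g z (df dg : R) :
  is_derive z 1 f df -> is_derive z 1 g dg ->
  is_derive z 1 (fun z => f z * g z) (df * g z + f z * dg).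
Proof.
move=> fz gz; have := is_deriveM fz gz.
by rewrite /GRing.scale/= [X in is_derive _ _ _ X]addrC [g z * _]mulrC.
Qed.

Lemma is_derive_scale (k : R) f z (df : R) :
  is_derive z 1 f df -> is_derive z 1 (fun z => k * f z) (k * df).
Proof. exact: is_deriveZ. Qed.

Lemma is_derive_continuous f z (df : R) :
  is_derive z 1 f df -> {for z, continuous f}.
Proof.
by case=> fz _; apply: differentiable_continuous; exact/derivable1_diffP.
Qed.

Lemma is_derive_sinpi z :
  is_derive z 1 (fun z => sin (pi * z)) (pi * cos (pi * z)).
Proof.
rewrite mulrC; apply: is_derive1_comp.
by have := is_derive_scale pi (is_derive_id z 1); rewrite mulr1.
Qed.

Lemma is_derive_cospi z :
  is_derive z 1 (fun z => cos (pi * z)) (- (pi * sin (pi * z))).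
Proof.
rewrite mulrC -mulNr; apply: is_derive1_comp.
by have := is_derive_scale pi (is_derive_id z 1); rewrite mulr1.
Qed.

Lemma continuous_sinpi : continuous (fun z : R => sin (pi * z)).
Proof. by move=> z; exact: is_derive_continuous (is_derive_sinpi z). Qed.

Lemma continuous_cospi : continuous (fun z : R => cos (pi * z)).
Proof. by move=> z; exact: is_derive_continuous (is_derive_cospi z). Qed.

Lemma sinpi_ge0 z : z \in `[0, 1] -> 0 <= sin (pi * z).
Proof.
rewrite in_itv/= => /andP[z0 z1]; apply: sin_ge0_pi.
by rewrite mulr_ge0 ?pi_ge0//= ler_piMr// pi_ge0.
Qed.

Definition softabs e u := Num.sqrt (u ^+ 2 + e ^+ 2).
Definition dsoftabs e u := u / softabs e u.
Definition ddsoftabs e u := e ^+ 2 / softabs e u ^+ 3.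

Lemma softabs_gt0 e u : 0 < e -> 0 < softabs e u.
Proof. by move=> e0; rewrite sqrtr_gt0 ltr_wpDl ?sqr_ge0// exprn_gt0. Qed.

Lemma sqr_softabs e u : softabs e u ^+ 2 = u ^+ 2 + e ^+ 2.
Proof. by rewrite sqr_sqrtr// addr_ge0// sqr_ge0. Qed.

Lemma norm_le_softabs e u : `|u| <= softabs e u.
Proof. by rewrite -sqrtr_sqr ler_sqrt ?addr_ge0 ?sqr_ge0// lerDl sqr_ge0. Qed.

Lemma softabs_le e u : 0 < e -> softabs e u <= `|u| + e.
Proof.
move=> e0; have ue0 : 0 <= `|u| + e by rewrite addr_ge0// ltW.
rewrite -(ler_sqr (ltW (softabs_gt0 u e0)))// sqr_softabs sqrrD.
rewrite real_normK ?num_real//.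
by rewrite lerD2r lerDl mulrn_wge0// mulr_ge0// ltW.
Qed.

Lemma norm_dsoftabs_le1 e u : 0 < e -> `|dsoftabs e u| <= 1.
Proof.
move=> e0; rewrite normrM normfV (gtr0_norm (softabs_gt0 u e0)).
by rewrite ler_pdivrMr ?softabs_gt0// mul1r norm_le_softabs.
Qed.

Lemma ddsoftabs_ge0 e u : 0 <= ddsoftabs e u.
Proof. by rewrite divr_ge0 ?sqr_ge0// exprn_ge0// sqrtr_ge0. Qed.

Lemma is_derive_softabs e u : 0 < e -> is_derive u 1 (softabs e) (dsoftabs e u).
Proof.
move=> e0.
have sq : is_derive u 1 (fun u => u ^+ 2 + e ^+ 2) (2 * u).
  have := is_deriveD (is_derive_mulr (is_derive_id u 1) (is_derive_id u 1))
    (is_derive_cst (e ^+ 2) u 1).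
  by rewrite mul1r mulr1 addr0 -mulr2n mulr_natl.
have u2e : 0 < u ^+ 2 + e ^+ 2 by rewrite -sqr_softabs exprn_gt0// softabs_gt0.
have -> : dsoftabs e u = (2 * softabs e u)^-1 * (2 * u).
  by rewrite /dsoftabs; field; rewrite gt_eqF// softabs_gt0.
exact: (@is_derive1_comp _ Num.sqrt (fun u => u ^+ 2 + e ^+ 2) u _ _
  (is_derive1_sqrt u2e) sq).
Qed.

Lemma is_derive_dsoftabs e u :
  0 < e -> is_derive u 1 (dsoftabs e) (ddsoftabs e u).
Proof.
move=> e0; have p0 : softabs e u != 0 by rewrite gt_eqF// softabs_gt0.
have := is_derive_mulr (is_derive_id u 1)
  (is_deriveV p0 (is_derive_softabs u e0)).
rewrite (_ : _ + _ = ddsoftabs e u)//.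
rewrite /ddsoftabs (_ : e ^+ 2 = softabs e u ^+ 2 - u ^+ 2); last first.
  by rewrite sqr_softabs; ring.
by rewrite /dsoftabs /GRing.scale/=; field.
Qed.

Lemma continuous_softabs e : 0 < e -> continuous (softabs e).
Proof. by move=> e0 u; exact: is_derive_continuous (is_derive_softabs u e0). Qed.

Lemma continuous_dsoftabs e : 0 < e -> continuous (dsoftabs e).
Proof. by move=> e0 u; exact: is_derive_continuous (is_derive_dsoftabs u e0). Qed.

Lemma continuous_ddsoftabs e : 0 < e -> continuous (ddsoftabs e).
Proof.
move=> e0 u; apply: cvgM; first exact: cvg_cst.
apply: cvgV; first by rewrite expf_neq0// gt_eqF// softabs_gt0.
exact: (continuous_comp (continuous_softabs e0 (x := u))
  (@exprn_continuous R 3 (softabs e u))).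
Qed.

Lemma within_continuous_sinpiM f : {within `[0, 1], continuous f} ->
  {within `[0, 1], continuous (fun z => sin (pi * z) * f z)}.
Proof.
apply: within_continuousM.
by apply: continuous_subspaceT; exact: continuous_sinpi.
Qed.

(** Kato's inequality for the weight [w = sin (pi z)] and the convex function
    [p = softabs e], without boundary conditions on [y].  The function
    [F = w p'(y) y' - w' p(y)] has derivative
    [w p'(y) y'' + pi^2 w p(y) + w p''(y) y'^2], whose last term is
    nonnegative, and [F 1 - F 0] is the right-hand side since [w] vanishes at
    both ends where [w' = pi] and [w' = - pi]. *)
Lemma weighted_kato e (y y1 y2 : R -> R) : 0 < e ->
  {within `[0, 1], continuous y} -> {within `[0, 1], continuous y1} ->
  {within `[0, 1], continuous y2} ->
  (forall z : R, z \in `]0, 1[ -> is_derive z 1 y (y1 z)) ->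
  (forall z : R, z \in `]0, 1[ -> is_derive z 1 y1 (y2 z)) ->
  int01 (fun z : R => sin (pi * z) * (dsoftabs e (y z) * y2 z)) +
    pi ^+ 2 * int01 (fun z : R => sin (pi * z) * softabs e (y z))
  <= pi * (softabs e (y 0) + softabs e (y 1)).
Proof.
move=> e0 cy cy1 cy2 dy dy1.
have cc : {within `[0, 1], continuous (fun z : R => cos (pi * z))}.
  by apply: continuous_subspaceT; exact: continuous_cospi.
have ck (k : R) := @within_continuous_cst R `[0, 1] k.
have cp := within_continuous_post (continuous_softabs e0) cy.
have cdp := within_continuous_post (continuous_dsoftabs e0) cy.
have cddp := within_continuous_post (continuous_ddsoftabs e0) cy.
have cM := @within_continuousM R `[0, 1].
have cS := within_continuous_sinpiM.
pose A (z : R) := sin (pi * z) * (dsoftabs e (y z) * y2 z).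
pose B (z : R) := sin (pi * z) * softabs e (y z).
pose D (z : R) := sin (pi * z) * (ddsoftabs e (y z) * y1 z * y1 z).
have cA : {within `[0, 1], continuous A} by apply: cS; exact: cM.
have cB : {within `[0, 1], continuous B} by exact: cS.
have cD : {within `[0, 1], continuous D}.
  by apply: cS; apply: (cM) => //; exact: cM.
have cpB : {within `[0, 1], continuous (fun z : R => pi ^+ 2 * B z)} by exact: cM.
have cAB : {within `[0, 1], continuous (fun z : R => A z + pi ^+ 2 * B z)}.
  exact: within_continuousD.
have cABD : {within `[0, 1], continuous (fun z : R => A z + pi ^+ 2 * B z + D z)}.
  exact: within_continuousD.
pose F (z : R) := sin (pi * z) * (dsoftabs e (y z) * y1 z) +
  (- pi) * (cos (pi * z) * softabs e (y z)).
have cF : {within `[0, 1], continuous F}.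
  apply: within_continuousD; first by apply: cS; exact: cM.
  by apply: (cM) => //; exact: cM.
have dF (z : R) : z \in `]0, 1[ -> is_derive z 1 F (A z + pi ^+ 2 * B z + D z).
  move=> z01.
  have dpy := @is_derive1_comp _ (softabs e) y z _ _
    (is_derive_softabs (y z) e0) (dy z z01).
  have ddpy := @is_derive1_comp _ (dsoftabs e) y z _ _
    (is_derive_dsoftabs (y z) e0) (dy z z01).
  have H := is_deriveD
    (is_derive_mulr (is_derive_sinpi z) (is_derive_mulr ddpy (dy1 z z01)))
    (is_derive_scale (- pi) (is_derive_mulr (is_derive_cospi z) dpy)).
  by apply: (is_derive_eq H); rewrite /A /B /D /=; ring.
have <- : int01 (fun z : R => A z + pi ^+ 2 * B z + D z) =
    pi * (softabs e (y 0) + softabs e (y 1)).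
  by rewrite (int01_derive cF cABD dF) /F !mulr1 !mulr0 sinpi cospi sin0 cos0; ring.
rewrite -int01Z// -int01D//; apply: ler_int01 => // z z01.
rewrite lerDl mulr_ge0 ?sinpi_ge0// -mulrA mulr_ge0 ?ddsoftabs_ge0//.
by rewrite -expr2 sqr_ge0.
Qed.

End weight_and_softabs.

(** * The weighted norm and its regularisation *)

Section weighted_norm.
Context {R : realType}.
Implicit Types (g y : R -> R) (e K : R).

Lemma sup_over_sin_ge0 g : (0 <= sup_over_sin g)%E.
Proof.
have h01 : (1 / 2 : R) \in `]0, 1[ by rewrite in_itv/=; apply/andP; split; lra.
apply: le_trans (ereal_sup_ubound _); last by exists (1 / 2).
by rewrite lee_fin divr_ge0// sinpi_ge0//; exact: subset_itv_oo_cc h01.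
Qed.

(** The supremum only controls the open interval; the vanishing of [g] at both
    ends extends the bound to the closed one. *)
Lemma norm_le_sup_over_sin g K (z : R) :
  sup_over_sin g = K%:E -> g 0 = 0 -> g 1 = 0 -> z \in `[0, 1] ->
  `|g z| <= K * sin (pi * z).
Proof.
move=> gK g0 g1; rewrite in_itv/= => /andP[].
rewrite le_eqVlt => /predU1P[<- _|z0].
  by rewrite g0 mulr0 sin0 mulr0 normr0.
rewrite le_eqVlt => /predU1P[->|z1].
  by rewrite g1 mulr1 sinpi mulr0 normr0.
have s0 : 0 < sin (pi * z).
  by rewrite sin_gt0_pi// mulr_gt0 ?pi_gt0//= gtr_pMr// pi_gt0.
rewrite -ler_pdivrMr// -lee_fin -gK; apply: ereal_sup_ubound.
by exists z => //; rewrite /= in_itv/= z0.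
Qed.

Lemma norm1w_continuous y : {within `[0, 1], continuous y} ->
  {within `[0, 1], continuous (fun z : R => sin (pi * z) * `|y z|)}.
Proof.
move=> cy; apply: within_continuous_sinpiM.
by apply: within_continuous_post cy; exact: norm_continuous.
Qed.

Lemma norm_int01_le_norm1w g y K :
  {within `[0, 1], continuous g} -> {within `[0, 1], continuous y} ->
  (forall z : R, z \in `[0, 1] -> `|g z| <= K * sin (pi * z)) ->
  `|int01 (fun z : R => g z * y z)| <= K * norm1w y.
Proof.
move=> cg cy gK; rewrite /norm1w -int01Z; last exact: norm1w_continuous.
have cgy := within_continuousM cg cy.
apply: le_trans (ler_norm_int01 cgy) _; apply: ler_int01.
- by apply: within_continuous_post cgy; exact: norm_continuous.
- apply: within_continuousM (norm1w_continuous cy).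
  exact: within_continuous_cst.
- by move=> z z01; rewrite normrM mulrA ler_wpM2r// gK.
Qed.

Definition soft_norm1w e y :=
  int01 (fun z : R => sin (pi * z) * softabs e (y z)).

Lemma soft_norm1w_continuous e y : 0 < e -> {within `[0, 1], continuous y} ->
  {within `[0, 1], continuous (fun z : R => sin (pi * z) * softabs e (y z))}.
Proof.
move=> e0 cy; apply: within_continuous_sinpiM.
by apply: within_continuous_post cy; exact: continuous_softabs.
Qed.

Lemma norm1w_le_soft_norm1w e y : 0 < e -> {within `[0, 1], continuous y} ->
  norm1w y <= soft_norm1w e y.
Proof.
move=> e0 cy; apply: ler_int01.
- exact: norm1w_continuous.
- exact: soft_norm1w_continuous.
- by move=> z z01; rewrite ler_wpM2l ?sinpi_ge0// norm_le_softabs.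
Qed.

Lemma soft_norm1w_le e y : 0 < e -> {within `[0, 1], continuous y} ->
  soft_norm1w e y <= norm1w y + e.
Proof.
move=> e0 cy.
have ce := @within_continuous_cst R `[0, 1] e.
have -> : norm1w y + e = int01 (fun z : R => sin (pi * z) * `|y z| + e).
  by rewrite int01D// ?int01_cst//; exact: norm1w_continuous.
apply: ler_int01; first exact: soft_norm1w_continuous.
  by apply: within_continuousD => //; exact: norm1w_continuous.
move=> z z01; apply: (@le_trans _ _ (sin (pi * z) * (`|y z| + e))).
  by rewrite ler_wpM2l ?sinpi_ge0// softabs_le.
by rewrite mulrDr lerD2l ler_piMl ?sin_le1// ltW.
Qed.

(** The inequality says that [expR (d * s) * (W s - c / d)] is nonincreasing. *)
Lemma linear_gronwall (W W' : R -> R) (d c t : R) : 0 < d -> 0 <= c -> 0 <= t ->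
  {within `[0, t], continuous W} ->
  (forall s : R, 0 < s -> is_derive s 1 W (W' s)) ->
  (forall s : R, 0 < s -> W' s <= - d * W s + c) ->
  W t <= expR (- d * t) * W 0 + c / d.
Proof.
move=> d0 c0 t0 cW dW W'le.
pose H (s : R) := expR (d * s) * (W s - c / d).
have dexp (s : R) : is_derive s 1 (fun s : R => expR (d * s)) (d * expR (d * s)).
  rewrite mulrC; apply: is_derive1_comp.
  by have := is_derive_scale d (is_derive_id s 1); rewrite mulr1.
have dH (s : R) : 0 < s ->
    is_derive s 1 H (expR (d * s) * (d * W s - c + W' s)).
  move=> s0.
  have dWc : is_derive s 1 (fun s : R => W s - c / d) (W' s - 0).
    exact: (is_deriveB (dW s s0) (is_derive_cst (c / d) s 1)).
  apply: (is_derive_eq (is_derive_mulr (dexp s) dWc)).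
  by field; rewrite gt_eqF.
have cH : {within `[0, t], continuous H}.
  apply: within_continuousM.
    by apply: continuous_subspaceT => s; exact: is_derive_continuous (dexp s).
  by apply: within_continuousB => //; exact: within_continuous_cst.
have : H t <= H 0.
  apply: (ler0_derive1_le_cc _ _ cH) => //; rewrite ?in_itv/= ?lexx ?t0//.
  - by move=> s; rewrite in_itv/= => /andP[/dH[]].
  - move=> s; rewrite in_itv/= => /andP[s0 _]; rewrite derive1E.
    have [_ ->] := dH s s0; rewrite pmulr_rle0 ?expR_gt0//.
    by have := W'le s s0; lra.
rewrite /H mulr0 expR0 mul1r => Ht.
have {}Ht : W t - c / d <= expR (- d * t) * (W 0 - c / d).
  by rewrite mulNr expRN ler_pdivlMl ?expR_gt0.
have : 0 <= expR (- d * t) * (c / d).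
  by rewrite mulr_ge0 ?expR_ge0// divr_ge0// ltW.
by move: Ht; rewrite mulrBr; lra.
Qed.

End weighted_norm.

(** * Decay along solutions *)

Section decay.
Context {R : realType}.
Variables (a : R) (g0 g1 x0 : R -> R) (x : R -> R -> R).
Hypothesis sol : is_solution a g0 g1 x0 x.

Lemma solution_profile_continuous (t : R) :
  0 <= t -> {within `[0, 1], continuous (x t)}.
Proof.
by move=> t0; apply: (C0_on2_row (sol_C0 sol)); rewrite /= in_itv/= t0.
Qed.

Lemma is_derive_soft_norm1w (e : R) : 0 < e ->
  exists xt : R -> R -> R,
   (forall t z : R, 0 < t -> z \in `[0, 1] -> is_derive t 1 (x^~ z) (xt t z)) /\
   forall t : R, 0 < t -> is_derive t 1 (fun t : R => soft_norm1w e (x t))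
     (int01 (fun z : R => sin (pi * z) * (dsoftabs e (x t z) * xt t z))).
Proof.
move=> e0; have [cx [xt [xz [dxt _ cxt _]]]] := sol_C1 sol.
have dx (t z : R) : 0 < t -> z \in `[0, 1] -> is_derive t 1 (x^~ z) (xt t z).
  move=> t0 z01; have t0' : `]0, +oo[%classic t by rewrite /= in_itv/= t0.
  apply: deriv_within_is_derive (dxt t z t0' z01).
  by apply: open_nbhs_nbhs; split; [exact: interval_open | exact: t0'].
exists xt; split=> // t t0.
(* Compactness of [t / 2, 2 t] bounds the time derivative near [t]. *)
have h2 : `[t / 2, 2 * t] `<=` `]0, +oo[%classic.
  move=> r /=; rewrite !in_itv/= andbT => /andP[r1 _].
  by apply: lt_le_trans r1; rewrite divr_gt0.
have [C C0 xtC] := C0_on2_bounded cxt h2.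
have pos (r : R) : r \in `]t / 2, 2 * t[ -> 0 < r.
  by rewrite in_itv/= => /andP[r1 _]; apply: lt_trans r1; rewrite divr_gt0.
apply: (@is_derive_int01 _ (fun t z : R => sin (pi * z) * softabs e (x t z))
  (fun t z : R => sin (pi * z) * (dsoftabs e (x t z) * xt t z))
  (t / 2) t (2 * t) C).
- by rewrite in_itv/=; apply/andP; split; lra.
- move=> r /pos r0; apply: soft_norm1w_continuous => //.
  exact/solution_profile_continuous/ltW.
- move=> r z /pos r0 z01; apply: is_derive_scale.
  exact: (@is_derive1_comp _ (softabs e) (x^~ z) r _ _
    (is_derive_softabs _ e0) (dx r z r0 z01)).
- move=> r z rt z01; rewrite normrM -[leRHS]mul1r ler_pM ?sin_max// normrM.
  rewrite -[leRHS]mul1r ler_pM ?norm_dsoftabs_le1// xtC//.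
  exact: subset_itv_oo_cc rt.
Qed.

(** Up to the regularisation error, the boundary traces are bounded by [K0] and
    [K1] times the norm, so that the boundary terms of [weighted_kato] are
    absorbed by its dissipation term [pi ^+ 2]. *)
Lemma soft_norm1w_decay (e K0 K1 : R) :
  0 < a -> 0 < e -> 0 <= K0 -> 0 <= K1 -> K0 + K1 < pi ->
  {within `[0, 1], continuous g0} -> {within `[0, 1], continuous g1} ->
  (forall z : R, z \in `[0, 1] -> `|g0 z| <= K0 * sin (pi * z)) ->
  (forall z : R, z \in `[0, 1] -> `|g1 z| <= K1 * sin (pi * z)) ->
  let d := a * pi * (pi - (K0 + K1)) in
  forall t : R, 0 <= t ->
  soft_norm1w e (x t) <=
    expR (- d * t) * soft_norm1w e (x 0) + (2 * a * pi * e) / d.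
Proof.
move=> a0 e0 K00 K10 Kpi cg0 cg1 g0K g1K d t t0.
have d0 : 0 < d by rewrite !mulr_gt0 ?pi_gt0// subr_gt0.
have [xt [dx dW]] := is_derive_soft_norm1w e0.
apply: (linear_gronwall d0 _ t0 _ dW).
- by rewrite !mulr_ge0 ?pi_ge0// ltW.
- apply: continuous_int01 => //.
  have := sol_C0 sol; rewrite /C0_on2 => c p.
  apply: cvgM.
    apply: (@continuous_subspaceT _ _ _ (fun p : R * R => sin (pi * p.2))).
    move=> q; apply: (@continuous_comp _ _ _ snd (fun z : R => sin (pi * z))).
      exact: cvg_snd.
    exact: continuous_sinpi.
  by apply: continuous_comp; [exact: c|exact: continuous_softabs].
move=> s s0.
have cxs := solution_profile_continuous (ltW s0).
have [y1 [y2 [cy1 cy2 dy dy1 y2E]]] := C2_on_derivatives (sol_C2 sol (ltW s0)).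
have xtE : int01 (fun z : R => sin (pi * z) * (dsoftabs e (x s z) * xt s z)) =
    a * int01 (fun z : R => sin (pi * z) * (dsoftabs e (x s z) * y2 z)).
  rewrite -int01Z; last first.
    apply: within_continuous_sinpiM; apply: within_continuousM => //.
    by apply: within_continuous_post cxs; exact: continuous_dsoftabs.
  (* The equation holds only in the interior; at the ends the weight is 0. *)
  apply: eq_int01 => z; rewrite in_itv/= => /andP[].
  rewrite le_eqVlt => /predU1P[<- _|z0]; first by rewrite mulr0 sin0 !mul0r mulr0.
  rewrite le_eqVlt => /predU1P[->|z1]; first by rewrite mulr1 sinpi !mul0r mulr0.
  have z01 : z \in `]0, 1[ by rewrite in_itv/= z0.
  have /(sol_pde sol s0) : 0 < z < 1 by rewrite z0.
  rewrite y2E// derive1E.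
  have [_ ->] := dx s z s0 (subset_itv_oo_cc z01 : z \in `[0, 1]).
  by move=> ->; ring.
have K := weighted_kato e0 cxs cy1 cy2 dy dy1.
have b0 : `|x s 0| <= K0 * soft_norm1w e (x s).
  rewrite (sol_bc0 sol (ltW s0)).
  apply: le_trans (norm_int01_le_norm1w cg0 cxs g0K) _.
  by rewrite ler_wpM2l// norm1w_le_soft_norm1w.
have b1 : `|x s 1| <= K1 * soft_norm1w e (x s).
  rewrite (sol_bc1 sol (ltW s0)).
  apply: le_trans (norm_int01_le_norm1w cg1 cxs g1K) _.
  by rewrite ler_wpM2l// norm1w_le_soft_norm1w.
have p0 := softabs_le (x s 0) e0; have p1 := softabs_le (x s 1) e0.
rewrite xtE /d.
set I := int01 _ in K *; rewrite -/(soft_norm1w e (x s)) in K.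
set E := soft_norm1w e (x s) in K b0 b1 *.
have {p0 p1 b0 b1} B : pi * (softabs e (x s 0) + softabs e (x s 1)) <=
   pi * ((K0 + K1) * E + 2 * e).
  by rewrite ler_wpM2l ?pi_ge0//; lra.
have {K B} : a * (I + pi ^+ 2 * E) <= a * (pi * ((K0 + K1) * E + 2 * e)).
  by rewrite ler_pM2l//; exact: le_trans K B.
by lra.
Qed.

End decay.

Theorem theorem3p3 (R : realType) (a : R) (g0 g1 : R -> R)
    (Delta : set (R -> R)) :
  0 < a ->
  C_on `[0, 1] 1 g0 ->
  C_on `[0, 1] 1 g1 ->
  admissible a g0 g1 Delta ->
  g0 0 = 0 -> g0 1 = 0 -> g1 0 = 0 -> g1 1 = 0 ->
  (sup_over_sin g0 + sup_over_sin g1 < pi%:E)%E ->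
  exists M delta : R,
    [/\ 0 < M, 0 < delta &
      forall x0, Delta x0 -> forall x, is_solution a g0 g1 x0 x ->
      forall t, 0 <= t ->
        norm1w (x t) <= M * expR (- delta * t) * norm1w (x 0)].
Proof.
move=> a0 [cg0 _] [cg1 _] _ g00 g01 g10 g11.
have := sup_over_sin_ge0 g0; case g0K : (sup_over_sin g0) => [K0| |] //=; last first.
  by have := sup_over_sin_ge0 g1; case: (sup_over_sin g1).
have := sup_over_sin_ge0 g1; case g1K : (sup_over_sin g1) => [K1| |] //=.
rewrite -EFinD !lee_fin lte_fin => K10 K00 Kpi.
exists 1, (a * pi * (pi - (K0 + K1))).
set d := a * pi * _.
have d0 : 0 < d by rewrite !mulr_gt0 ?pi_gt0// subr_gt0.
split=> // x0 _ x sol t t0; rewrite mul1r.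
(* The total error is [c * e], so that [e = eps / c] makes it equal to [eps]. *)
set c := 1 + 2 * a * pi / d.
have c0 : 0 < c by rewrite ltr_pwDl// divr_ge0 ?(ltW d0)// !mulr_ge0 ?pi_ge0// ltW.
apply/ler_addgt0Pr => eps eps0.
pose e := eps / c; have e0 : 0 < e by rewrite divr_gt0.
have H := soft_norm1w_decay sol a0 e0 K00 K10 Kpi cg0 cg1
  (fun z => norm_le_sup_over_sin g0K g00 g01)
  (fun z => norm_le_sup_over_sin g1K g10 g11) t0.
apply: le_trans (norm1w_le_soft_norm1w e0 (solution_profile_continuous sol t0)) _.
apply: le_trans H _; rewrite -/d.
have -> : eps = e + 2 * a * pi * e / d.
  by rewrite -[LHS](@divfK _ c) ?gt_eqF// -/e /c; ring.
rewrite addrA lerD2r.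
have E1 : expR (- d * t) <= 1 by rewrite -expR0 ler_expR mulNr oppr_le0 mulr_ge0// ltW.
apply: (@le_trans _ _ (expR (- d * t) * (norm1w (x 0) + e))).
  by rewrite ler_wpM2l ?expR_ge0// soft_norm1w_le//; exact: solution_profile_continuous sol _ _.
by rewrite mulrDr lerD2l ler_piMl// ltW.
Qed.
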